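(* Let $X$ be a real normed space with $\dim X\ge 2$ (possibly infinite-dimensional). Then $X$ satisfies property (SRS2), i.e. every set of three affine independent points of $X$ resolves its convex hull, if and only if $X$ is strictly convex.
   Context: Let $X$ be a real normed space with norm $\|\cdot\|$ and let $R,S\subseteq X$. We say that $R$ resolves $S$ (or $R$ is a resolving set for $S$) if for any $s_1,s_2\in S$, the equations $\|r-s_1\|=\|r-s_2\|$ for all $r\in R$ imply $s_1=s_2$. For $d\in\mathbb{N}$, $d\ge 2$, a normed space $X$ with $\dim X\ge d$ has property (SRS$d$) if every set of $d+1$ affine independent points of $X$ resolves its convex hull; (SRS2) is the case $d=2$. $X$ is strictly convex if its unit sphere contains no non-degenerate line segment. *)

(* Defs.v *)
From HB Require Import structures.
From mathcomp Require Export all_boot all_order all_algebra.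
From mathcomp Require Export all_classical all_reals all_analysis.
Export numFieldNormedType.Exports.

Set Implicit Arguments.
Unset Strict Implicit.
Unset Printing Implicit Defensive.

Import Order.TTheory GRing.Theory Num.Theory.
Local Open Scope classical_set_scope.
Local Open Scope ring_scope.
Local Open Scope convex_scope.

Definition linearly_independent (R : realType) (V : lmodType R) (n : nat)
    (v : 'I_n -> V) : Prop :=
  forall c : 'I_n -> R, \sum_i c i *: v i = 0 -> forall i, c i = 0.

(* [free] and [\dim] require a [vectType], hence finite dimension; this also
   covers infinite-dimensional spaces. *)
Definition dim_at_least (R : realType) (V : lmodType R) (n : nat) : Prop :=
  exists v : 'I_n -> V, linearly_independent v.

Definition affinely_independent (R : realType) (V : lmodType R) (n : nat)
    (p : 'I_n -> V) : Prop :=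
  forall c : 'I_n -> R,
    \sum_i c i = 0 -> \sum_i c i *: p i = 0 -> forall i, c i = 0.

Definition convex_hull (R : realType) (V : lmodType R) (A : set V) : set V :=
  smallest (@convex_set R V) A.

Definition segment (R : realType) (V : lmodType R) (x y : V) : set V :=
  [set (x : convex_lmodType V) <| t |> y | t in [set: {i01 R}]].

Definition unit_sphere (R : realType) (X : normedModType R) : set X :=
  [set x | `|x| = 1].

Definition strictly_convex (R : realType) (X : normedModType R) : Prop :=
  forall x y : X, x != y -> ~ (segment x y `<=` @unit_sphere R X).

Definition resolves (R : realType) (X : normedModType R) (A S : set X) : Prop :=
  forall s1 s2 : X, S s1 -> S s2 ->
    (forall r, A r -> `|r - s1| = `|r - s2|) -> s1 = s2.

(* An affinely independent family is injective, so [range p] is a set of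
   exactly d + 1 points. The property is meant for spaces of dimension at
   least d >= 2. *)
Definition SRS (d : nat) (R : realType) (X : normedModType R) : Prop :=
  forall p : 'I_d.+1 -> X, affinely_independent p ->
    resolves (range p) (convex_hull (range p)).

(* Main.v *)
Require Import Defs.
From mathcomp Require Import ring lra.

Set Implicit Arguments.
Unset Strict Implicit.
Unset Printing Implicit Defensive.

Import Order.TTheory GRing.Theory Num.Theory.
Local Open Scope classical_set_scope.
Local Open Scope ring_scope.

(** Strict convexity gives (SRS2) through a normed version of Euclid I.7: if
    [w1] and [w2] lie in one closed half-plane bounded by the line through two
    points [0] and [u], and are equally far from [0] and equally far from [u],
    then [w1 = w2]. Say [w2] is at least as far from the line as [w1], and
    write [w1 = t w2 + k u] with [0 <= t <= 1]. Either [w1] lies in the triangle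
    [0, u, w2], and then a path from [0] to [u] through [w2] would not be longer
    than the one through the inner point [w1] (here the strict triangle
    inequality [|u| < |w2| + |w2 - u|] is contradicted), or one of the pairs of
    segments [0 w2, u w1] and [0 w1, u w2] consists of the crossing diagonals of
    a quadrilateral, whose total length strictly exceeds that of two opposite
    sides. These are [no_crossing] and [equidistant_same_side]. Since a triangle
    lies on one side of the line through any two of its vertices, already two
    vertices resolve it.

    Conversely, if the unit sphere contains a nondegenerate segment with
    midpoint [m] and half-difference [d], then [|a m + b d| = |a|] whenever
    [|b| <= |a|]. The norm is thus blind to small moves in the direction [d],
    and the triangle [m, - m + d/2, - m - d/2] contains the points [d/4] and
    [- d/4], whose differences with each vertex have the form [+- m + s d] with
    [|s| <= 1], hence norm [1]. *)

(** * Linear identities *)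

(** An identity between combinations of [x], [y], [z] follows by comparing
    coefficients. Keeping [L] abstract makes it impossible to rewrite [x], [y]
    and [z] inside their own coordinate form, so every combination normalizes
    to a single [L a b c]. *)
Lemma linear_coordinates (R : realType) (V : lmodType R) (x y z : V) :
  exists L : R -> R -> R -> V,
    [/\ L 0 0 0 = 0, x = L 1 0 0, y = L 0 1 0 & z = L 0 0 1] /\
    [/\ forall a b c a' b' c',
          L a b c + L a' b' c' = L (a + a') (b + b') (c + c'),
        forall a b c, - L a b c = L (- a) (- b) (- c) &
        forall k a b c, k *: L a b c = L (k * a) (k * b) (k * c)].
Proof.
exists (fun a b c => a *: x + b *: y + c *: z); split; split.
- by rewrite !scale0r !addr0.
- by rewrite !scale0r scale1r !addr0.
- by rewrite !scale0r scale1r addr0 add0r.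
- by rewrite !scale0r scale1r !add0r.
- by move=> *; rewrite !scalerDl addrACA; congr (_ + _); exact: addrACA.
- by move=> *; rewrite !scaleNr !opprD.
- by move=> *; rewrite !scalerDr !scalerA.
Qed.

(** Leaves the equality of the coefficients as scalar goals. With only two
    vectors the last argument repeats the second one. *)
Ltac linear_identity x y z :=
  let L := fresh "L" in let L0 := fresh in
  let Lx := fresh in let Ly := fresh in let Lz := fresh in
  let LD := fresh in let LN := fresh in let LZ := fresh in
  have [L [[L0 Lx Ly Lz] [LD LN LZ]]] := linear_coordinates x y z;
  rewrite ?Lx ?Ly ?Lz -?L0 ?(LN, LZ, LD);
  congr L.

(** The unindexed form of linear independence for a pair. *)
Definition independent (R : realType) (V : lmodType R) (x y : V) :=
  forall a b : R, a *: x + b *: y = 0 -> a = 0 /\ b = 0.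

Lemma independent_comb (R : realType) (V : lmodType R) (x y : V)
    (a b c d : R) :
  independent x y -> a * d - b * c != 0 ->
  independent (a *: x + b *: y) (c *: x + d *: y).
Proof.
move=> xy D k l kl.
have [e1 e2] : k * a + l * c = 0 /\ k * b + l * d = 0.
  by apply: xy; rewrite -[RHS]kl; linear_identity x y y; ring.
split; apply: (mulIf D); rewrite mul0r.
- have -> : k * (a * d - b * c) =
    d * (k * a + l * c) - c * (k * b + l * d) by ring.
  by rewrite e1 e2 !mulr0 subr0.
- have -> : l * (a * d - b * c) =
    a * (k * b + l * d) - b * (k * a + l * c) by ring.
  by rewrite e1 e2 !mulr0 subr0.
Qed.

Lemma independent_neq0 (R : realType) (V : lmodType R) (x y : V) :
  independent x y -> x != 0 /\ y != 0.
Proof.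
move=> xy; split; apply/eqP => z0.
- have /xy[/eqP] : 1 *: x + 0 *: y = 0 by rewrite z0 scaler0 scale0r addr0.
  by rewrite oner_eq0.
- have /xy[_ /eqP] : 0 *: x + 1 *: y = 0 by rewrite z0 scaler0 scale0r addr0.
  by rewrite oner_eq0.
Qed.

(** * The strict triangle inequality *)

(** Equality in the triangle inequality propagates to the whole cone spanned by
    [x] and [y]: for [a <= b], apply the triangle inequality to
    [b (x + y) = (a x + b y) + (b - a) x], where the left side has the largest
    norm possible. *)
Lemma norm_comb_eq (R : realType) (X : normedModType R) (x y : X) (a b : R) :
  `|x + y| = `|x| + `|y| -> 0 <= a -> 0 <= b ->
  `|a *: x + b *: y| = a * `|x| + b * `|y|.
Proof.
move=> xy a0 b0; apply/eqP; rewrite eq_le; apply/andP; split.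
  by rewrite (le_trans (ler_normD _ _))// !normrZ !ger0_norm.
wlog ab : x y a b xy a0 b0 / a <= b => [hw|].
  have [ab|/ltW ba] := leP a b; first exact: hw.
  by rewrite addrC [X in _ <= `|X|]addrC; apply: hw => //; rewrite addrC xy addrC.
have : b * `|x + y| <= `|a *: x + b *: y| + (b - a) * `|x|.
  rewrite -[X in X * `|x + y|]ger0_norm// -normrZ.
  have -> : b *: (x + y) = (a *: x + b *: y) + (b - a) *: x.
    by linear_identity x y y; ring.
  by rewrite (le_trans (ler_normD _ _))// normrZ (ger0_norm (_ : 0 <= b - a))// subr_ge0.
rewrite xy; lra.
Qed.

(** Were equality to hold, every convex combination of the unit vectors
    [x / |x|] and [y / |y|] would have norm [1], giving a segment on the
    unit sphere. *)
Lemma strict_triangle (R : realType) (X : normedModType R) (x y : X) :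
  strictly_convex X -> independent x y -> `|x + y| < `|x| + `|y|.
Proof.
move=> sc xy; rewrite lt_neqAle ler_normD andbT; apply/eqP => eq_xy.
have [x0 y0] := independent_neq0 xy.
have nx : 0 < `|x| by rewrite normr_gt0.
have ny : 0 < `|y| by rewrite normr_gt0.
apply: (sc (`|x|^-1 *: x) (`|y|^-1 *: y)).
  apply/eqP => /eqP; rewrite -subr_eq0 -scaleNr => /eqP /xy[/eqP].
  by rewrite invr_eq0 normr_eq0 (negbTE x0).
move=> _ [t _ <-]; rewrite /unit_sphere /= /conv /= !scalerA norm_comb_eq//.
- by rewrite -!mulrA !mulVf ?gt_eqF// !mulr1 /unstable.onem; ring.
- by rewrite mulr_ge0 ?invr_ge0// /unstable.onem subr_ge0.
Qed.

(** * Euclid I.7 in a strictly convex space *)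

(** For [k < 0] the segments from [0] to [w2] and from [u] to [w1] cross at
    [z = t / (1 - k) w2]. Going through [z] gives
    [|w1| + |w2 - u| < |w2| + |w1 - u|], which the equal distances forbid.
    Multiplied by [1 - k], the two triangle inequalities through [z] become
    those for [(1 - k) w1 = t w2 - k (w1 - u)] and
    [(1 - k) (w2 - u) = (1 - k - t) w2 + (w1 - u)]. *)
Lemma no_crossing (R : realType) (X : normedModType R) (u w1 w2 : X)
    (t k : R) :
  strictly_convex X -> independent u w2 -> 0 <= t <= 1 -> k < 0 ->
  w1 = t *: w2 + k *: u ->
  `|w1| = `|w2| -> `|w1 - u| = `|w2 - u| -> False.
Proof.
move=> sc uw /andP[t0 t1] k0 def_w1 e0 eu.
have le0 : (1 - k) * `|w1| <= t * `|w2| - k * `|w1 - u|.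
  rewrite -[X in X * _ <= _](@ger0_norm _ (1 - k)); last lra.
  have -> : t * `|w2| - k * `|w1 - u| = `|t *: w2| + `|(- k) *: (w1 - u)|.
    by rewrite !normrZ !ger0_norm //; lra.
  rewrite -normrZ (_ : (1 - k) *: w1 = t *: w2 + (- k) *: (w1 - u)) ?ler_normD//.
  by rewrite def_w1; linear_identity u w2 w2; ring.
have ltu : (1 - k) * `|w2 - u| < (1 - k - t) * `|w2| + `|w1 - u|.
  rewrite -[X in X * _ < _](@ger0_norm _ (1 - k)); last lra.
  rewrite -[X in _ < X * _ + _](@ger0_norm _ (1 - k - t)); last lra.
  rewrite -!normrZ.
  have -> : (1 - k) *: (w2 - u) = (1 - k - t) *: w2 + (w1 - u).
    by rewrite def_w1; linear_identity u w2 w2; ring.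
  apply: strict_triangle => //.
  have -> : (1 - k - t) *: w2 = 0 *: u + (1 - k - t) *: w2.
    by linear_identity u w2 w2; ring.
  have -> : w1 - u = (k - 1) *: u + t *: w2.
    by rewrite def_w1; linear_identity u w2 w2; ring.
  apply: independent_comb => //.
  by rewrite mul0r sub0r oppr_eq0 mulf_neq0//; apply/eqP; lra.
rewrite e0 eu in le0 ltu; lra.
Qed.

(** The barycentric coordinates of [w1] with respect to [0], [u], [w2] are
    [1 - t - k], [k] and [t]. A negative one among the first two yields crossing
    diagonals; otherwise [w1] lies in the triangle [0, u, w2]. *)
Lemma equidistant_same_side (R : realType) (X : normedModType R)
    (u w1 w2 : X) (t k : R) :
  strictly_convex X -> independent u w2 -> 0 <= t <= 1 ->
  w1 = t *: w2 + k *: u ->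
  `|w1| = `|w2| -> `|w1 - u| = `|w2 - u| -> w1 = w2.
Proof.
move=> sc uw t01 def_w1 e0 eu; have /andP[t0 t1] := t01.
have [k0|k0] := ltP k 0.
  by case: (no_crossing sc uw t01 k0 def_w1 e0 eu).
have [k1|k1] := ltP (1 - t) k.
  (* Exchanging the roles of 0 and u, with u as origin, turns k into
     1 - t - k, so the diagonals now cross the other way. *)
  have k0' : 1 - t - k < 0 by lra.
  case: (@no_crossing _ _ (- u) (w1 - u) (w2 - u) t (1 - t - k) sc _ t01 k0').
  - have -> : - u = (-1) *: u + 0 *: w2 by linear_identity u w2 w2; ring.
    have -> : w2 + ((-1) *: u + 0 *: w2) = (-1) *: u + 1 *: w2.
      by linear_identity u w2 w2; ring.
    by apply: independent_comb => //; apply/eqP; lra.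
  - by rewrite def_w1; linear_identity u w2 w2; ring.
  - by [].
  - by rewrite !opprK !subrK.
(* From here on w1 lies in the triangle 0, u, w2. *)
have lt_u : `|u| < `|w2| + `|w2 - u|.
  rewrite (distrC w2 u) {1}(_ : u = w2 + (u - w2)); last by rewrite addrC subrK.
  apply: strict_triangle => //.
  have : independent (0 *: u + 1 *: w2) (1 *: u + (-1) *: w2).
    by apply: independent_comb => //; apply/eqP; lra.
  by rewrite scale0r !scale1r add0r scaleN1r.
have le0 : `|w1| <= t * `|w2| + k * `|u|.
  by rewrite def_w1 (le_trans (ler_normD _ _))// !normrZ !ger0_norm.
have leu : `|w1 - u| <= t * `|w2 - u| + (1 - t - k) * `|u|.
  have -> : w1 - u = t *: (w2 - u) + (1 - t - k) *: - u.
    by rewrite def_w1; linear_identity u w2 w2; ring.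
  by rewrite (le_trans (ler_normD _ _))// !normrZ normrN !ger0_norm//; lra.
have t_eq1 : t = 1.
  apply/eqP; rewrite eq_le t1 /= leNgt; apply/negP => lt1.
  have : (1 - t) * `|u| < (1 - t) * (`|w2| + `|w2 - u|).
    by rewrite ltr_pM2l// subr_gt0.
  rewrite e0 eu in le0 leu; lra.
have k_eq0 : k = 0 by lra.
by rewrite def_w1 t_eq1 k_eq0 scale1r scale0r addr0.
Qed.

(** * Strict convexity implies (SRS2) *)

(** Used for the triangle [o, o + u, o + v], which lies in the closed half-plane
    bounded by the line through [o] and [o + u]. *)
Lemma convex_hull_half_plane (R : realType) (V : lmodType R) (A : set V)
    (o u v : V) :
  (forall a, A a -> exists x y : R, 0 <= y /\ a = o + (x *: u + y *: v)) ->
  forall z, convex_hull A z ->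
  exists x y : R, 0 <= y /\ z = o + (x *: u + y *: v).
Proof.
move=> AH.
pose H := [set z | exists x y : R, 0 <= y /\ z = o + (x *: u + y *: v)].
apply: (@smallest_sub _ (@convex_set R V) A H) => //.
move=> a b t /[!inE] -[x1 [y1 [y1_ge0 ->]]] [x2 [y2 [y2_ge0 ->]]].
have [t0 t1] : 0 <= t%:num /\ t%:num <= 1 by [].
exists (t%:num * x1 + (1 - t%:num) * x2), (t%:num * y1 + (1 - t%:num) * y2).
split; first by rewrite addr_ge0// mulr_ge0// subr_ge0.
by rewrite /conv /= /unstable.onem; linear_identity o u v; ring.
Qed.

(** Euclid I.7 for the side through the vertices [0] and [1], which serve as
    the two centres. *)
Lemma strictly_convex_SRS2 (R : realType) (X : normedModType R) :
  strictly_convex X -> SRS 2 X.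
Proof.
move=> sc p p_ind s1 s2 s1P s2P eq_s.
pose i1 : 'I_3 := inord 1; pose i2 : 'I_3 := inord 2.
pose o := p ord0; pose u := p i1 - o; pose v := p i2 - o.
have uv : independent u v.
  move=> a b ab0.
  pose c (i : 'I_3) : R := nth 0 [:: - a - b; a; b] i.
  have sum3 (W : nmodType) (F : 'I_3 -> W) :
      \sum_i F i = F ord0 + F i1 + F i2.
    rewrite !big_ord_recl big_ord0 addr0 addrA.
    by congr (F _ + F _ + F _); apply/val_inj; rewrite /= inordK.
  have c1 : c i1 = a by rewrite /c inordK.
  have c2 : c i2 = b by rewrite /c inordK.
  have c_eq0 : forall i, c i = 0.
    apply: p_ind; first by rewrite sum3 c1 c2 /c /=; ring.
    rewrite sum3 c1 c2 /c /= -[RHS]ab0 /u /v -/o.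
    by linear_identity o (p i1) (p i2); ring.
  by rewrite -c1 -c2.
have hull_half_plane : forall z, convex_hull (range p) z ->
    exists x y : R, 0 <= y /\ z = o + (x *: u + y *: v).
  apply: convex_hull_half_plane => _ [i _ <-].
  have : [\/ i = ord0, i = i1 | i = i2].
    case: i => [[|[|[|//]]]] lt_i;
      [constructor 1|constructor 2|constructor 3]; apply/val_inj => //=;
      by rewrite inordK.
  case=> ->.
  - by exists 0, 0; rewrite !scale0r !addr0.
  - by exists 1, 0; rewrite scale0r scale1r addr0 addrC subrK.
  - by exists 0, 1; rewrite scale0r scale1r add0r addrC subrK.
have [x1 [y1 [y1_ge0 def_s1]]] := hull_half_plane _ s1P.
have [x2 [y2 [y2_ge0 def_s2]]] := hull_half_plane _ s2P.
have : `|o - s1| = `|o - s2| by apply: eq_s; exists ord0.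
have : `|p i1 - s1| = `|p i1 - s2| by apply: eq_s; exists i1.
have -> : p i1 = o + u by rewrite addrC subrK.
clearbody u v o; clear - sc uv y1_ge0 y2_ge0 def_s1 def_s2.
wlog le_y : s1 s2 x1 x2 y1 y2 y1_ge0 y2_ge0 def_s1 def_s2 / y1 <= y2 => [hw|].
  have [le_y|/ltW le_y eu eo] := leP y1 y2; first exact: (hw s1 s2 x1 x2 y1 y2).
  by apply/esym; apply: (hw s2 s1 x2 x1 y2 y1).
set w1 := x1 *: u + y1 *: v in def_s1; set w2 := x2 *: u + y2 *: v in def_s2.
rewrite def_s1 def_s2 => eu eo; congr (_ + _).
have e0 : `|w1| = `|w2|.
  have sub_o w : `|o - (o + w)| = `|w|.
    by rewrite opprD addrA subrr add0r normrN.
  by move: eo; rewrite !sub_o.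
have {}eu : `|w1 - u| = `|w2 - u|.
  have sub_u w : `|o + u - (o + w)| = `|w - u|.
    by rewrite opprD addrACA subrr add0r distrC.
  by move: eu; rewrite !sub_u.
(* Both points are on the line itself; equal distances to 0 and to u then
   determine the coordinate along u. *)
have [y2_eq0|y2_neq0] := eqVneq y2 0.
  have y1_eq0 : y1 = 0 by lra.
  have [u0 _] := independent_neq0 uv.
  have nu : `|u| != 0 by rewrite normr_eq0.
  have ex : `|x1| = `|x2|.
    apply: (mulIf nu); move: e0.
    by rewrite /w1 /w2 y1_eq0 y2_eq0 scale0r !addr0 !normrZ.
  have ex1 : `|x1 - 1| = `|x2 - 1|.
    apply: (mulIf nu); rewrite -!normrZ; move: eu.
    by rewrite /w1 /w2 y1_eq0 y2_eq0 scale0r !addr0 !scalerBl !scale1r.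
  suff ex12 : x1 = x2 by rewrite /w1 /w2 y1_eq0 y2_eq0 ex12.
  have : x1 ^+ 2 = x2 ^+ 2 by rewrite -[LHS]real_normK ?num_real// ex real_normK ?num_real.
  have : (x1 - 1) ^+ 2 = (x2 - 1) ^+ 2
    by rewrite -[LHS]real_normK ?num_real// ex1 real_normK ?num_real.
  rewrite !expr2; lra.
have y2_gt0 : 0 < y2 by rewrite lt_neqAle eq_sym y2_neq0.
apply: (@equidistant_same_side _ _ u w1 w2 (y1 / y2) (x1 - y1 / y2 * x2)) => //.
- have -> : u = 1 *: u + 0 *: v by rewrite scale0r scale1r addr0.
  by apply: independent_comb => //; rewrite mul1r mul0r subr0.
- by rewrite divr_ge0//= ler_pdivrMr// mul1r.
- by rewrite /w1 /w2; linear_identity u v v; field.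
Qed.

(** * (SRS2) implies strict convexity *)

Lemma convex_hull_midpoint (R : realType) (V : lmodType R) (A : set V)
    (a b : V) :
  A a -> A b -> convex_hull A (2^-1 *: a + 2^-1 *: b).
Proof.
move=> Aa Ab M [cM AM].
have h0 : 0 <= 2^-1 :> R by lra.
have h1 : 2^-1 <= 1 :> R by lra.
have /set_mem := cM a b (Itv01 h0 h1) (mem_set (AM _ Aa)) (mem_set (AM _ Ab)).
rewrite /conv /= /unstable.onem.
by have -> : 1 - 2^-1 = 2^-1 :> R by lra.
Qed.

(** With [m] and [d] as in the introduction, [m], [- m + d/2] and [- m - d/2]
    are affinely independent, and [d/4] and [- d/4] are the midpoints of the two
    sides through [m]. *)
Lemma SRS2_strictly_convex (R : realType) (X : normedModType R) :
  SRS 2 X -> strictly_convex X.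
Proof.
move=> srs x y x_neq_y xy_sphere.
pose m := 2^-1 *: (x + y); pose d := 2^-1 *: (y - x).
have norm_md (s : R) : `|s| <= 1 -> `|m + s *: d| = 1.
  rewrite ler_norml => /andP[s_ge s_le].
  have t0 : 0 <= (1 - s) / 2 by lra.
  have t1 : (1 - s) / 2 <= 1 by lra.
  suff : segment x y (m + s *: d) by exact: xy_sphere.
  exists (Itv01 t0 t1) => //; rewrite /conv /= /unstable.onem /m /d.
  by linear_identity x y y; field.
have d_neq0 : d != 0.
  by rewrite scaler_eq0 invr_eq0 pnatr_eq0 /= subr_eq0 eq_sym.
clearbody m d.
have norm_m : `|m| = 1.
  by rewrite -(norm_md 0) ?normr0// scale0r addr0.
(* If d were a multiple g m, then |1 + g| = |1 - g| = 1 would force g = 0. *)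
have md : independent m d.
  move=> a b ab0; have [b0|b_neq0] := eqVneq b 0.
    split=> //; move: ab0; rewrite b0 scale0r addr0 => /eqP.
    by rewrite scaler_eq0 -(normr_eq0 m) norm_m oner_eq0 orbF => /eqP.
  have def_d : d = (- (a / b)) *: m.
    apply: (scalerI b_neq0); rewrite scalerA. rewrite mulrN mulrCA divff// mulr1 scaleNr.
    by apply/eqP; rewrite -addr_eq0 addrC ab0.
  set g := - (a / b) in def_d.
  have norm_g (s : R) : `|s| <= 1 -> (1 + s * g) ^+ 2 = 1.
    move=> /norm_md; rewrite def_d scalerA -[X in X + _]scale1r -scalerDl normrZ.
    by rewrite norm_m mulr1 => e; rewrite -[LHS]real_normK ?num_real// e expr1n.
  suff g0 : g = 0 by rewrite def_d g0 scale0r eqxx in d_neq0.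
  have g1 : (1 + 1 * g) ^+ 2 = 1 by apply: norm_g; rewrite normr1.
  have gN1 : (1 + -1 * g) ^+ 2 = 1 by apply: norm_g; rewrite normrN1.
  rewrite !expr2 in g1 gN1; lra.
pose p (i : 'I_3) : X := nth 0 [:: m; - m + 2^-1 *: d; - m - 2^-1 *: d] i.
have p_ind : affinely_independent p.
  move=> c; rewrite !big_ord_recl !big_ord0 !addr0.
  set c0 := c _; set c1 := c _; set c2 := c _ => sum_c sum_cp.
  have /md[eq_m eq_d] : (c0 - c1 - c2) *: m + (2^-1 * (c1 - c2)) *: d = 0.
    by rewrite -[RHS]sum_cp /p /=; linear_identity m d d; ring.
  have c00 : c0 = 0 by lra.
  have c10 : c1 = 0 by lra.
  have c20 : c2 = 0 by lra.
  case=> [[|[|[|//]]]] lt_i; [rewrite -c00|rewrite -c10|rewrite -c20];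
    by congr (c _); apply/val_inj.
have rp i : range p (p i) by exists i.
pose i1 : 'I_3 := inord 1; pose i2 : 'I_3 := inord 2.
have p1 : p i1 = - m + 2^-1 *: d by rewrite /p inordK.
have p2 : p i2 = - m - 2^-1 *: d by rewrite /p inordK.
have := srs p p_ind _ _ (convex_hull_midpoint (rp ord0) (rp i1))
  (convex_hull_midpoint (rp ord0) (rp i2)).
have -> : 2^-1 *: p ord0 + 2^-1 *: p i1 = 4^-1 *: d.
  by rewrite p1 /p /=; linear_identity m d d; field.
have -> : 2^-1 *: p ord0 + 2^-1 *: p i2 = (- 4^-1) *: d.
  by rewrite p2 /p /=; linear_identity m d d; field.
have norm_Nmd (s : R) : `|s| <= 1 -> `|- m + s *: d| = 1.
  move=> s1; rewrite -normrN opprD opprK -scaleNr norm_md ?normrN//.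
move=> unresolved.
have /eqP : 4^-1 *: d = (- 4^-1) *: d.
  apply: unresolved => _ [[[|[|[|//]]] lt_i] _ <-]; rewrite /p /=.
  - by rewrite -!scaleNr !norm_md// ler_norml; lra.
  - have -> : - m + 2^-1 *: d - 4^-1 *: d = - m + 4^-1 *: d.
      by linear_identity m d d; field.
    have -> : - m + 2^-1 *: d - - 4^-1 *: d = - m + (3 / 4) *: d.
      by linear_identity m d d; field.
    by rewrite !norm_Nmd// ler_norml; lra.
  - have -> : - m - 2^-1 *: d - 4^-1 *: d = - m + (- (3 / 4)) *: d.
      by linear_identity m d d; field.
    have -> : - m - 2^-1 *: d - - 4^-1 *: d = - m + (- 4^-1) *: d.
      by linear_identity m d d; field.
    by rewrite !norm_Nmd// ler_norml; lra.
rewrite -subr_eq0 -scalerBl scaler_eq0 (negbTE d_neq0) orbF => /eqP; lra.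
Qed.

Theorem theorem2 (R : realType) (X : normedModType R) (hX : dim_at_least X 2) :
  SRS 2 X <-> strictly_convex X.
Proof.
by split; [exact: SRS2_strictly_convex | exact: strictly_convex_SRS2].
Qed.
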